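(* Let $\Gamma=W_{n+1}$ be the wheel graph on $n+1\ge 4$ vertices, with sink $v_*$ the central vertex and boundary vertices labeled cyclically $v_i$, $i\in\mathbb{Z}/n\mathbb{Z}$; let $\mathcal{V}'$ be the set of boundary vertices and write $\sigma_i=\sigma(v_i)$ for $\sigma\in\mathbb{Z}^{\mathcal{V}'}$ (indices modulo $n$). Let $F_k$ and $A_k$ denote the $k$th Fibonacci and Lucas numbers. Let $\sigma\in\mathbb{Z}^{\mathcal{V}'}$. Then $\sigma$ is in the image of $L':\mathbb{Z}^{\mathcal{V}'}\to\mathbb{Z}^{\mathcal{V}'}$ if and only if the following holds for all $i\in\mathbb{Z}/n\mathbb{Z}$: if $n$ is even, $$A_n\sigma_{i+n/2}+A_0\sigma_i+\sum_{m=1}^{\frac n2-1}A_{2m}(\sigma_{i+m}+\sigma_{i-m})\equiv 0 \pmod{5F_n};$$ if $n$ is odd, $$F_n\sigma_{i+(n+1)/2}+\sum_{m=1}^{\frac{n-1}{2}}F_{2m-1}(\sigma_{i+m}+\sigma_{i+1-m})\equiv 0 \pmod{A_n}.$$ In particular, if $\sigma$ is uniformly large, then $\sigma$ is immutable if and only if, for all $i\in\mathbb{Z}/n\mathbb{Z}$, one has $A_n\sigma_{i+n/2}+A_0\sigma_i+\sum_{m=1}^{\frac n2-1}A_{2m}(\sigma_{i+m}+\sigma_{i-m})\equiv 0 \pmod{5F_n}$ when $n$ is even, respectively $F_n\sigma_{i+(n+1)/2}+\sum_{m=1}^{\frac{n-1}{2}}F_{2m-1}(\sigma_{i+m}+\sigma_{i+1-m})\equiv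 0 \pmod{A_n}$ when $n$ is odd.
   Context: The wheel graph $W_{n+1}$ is an $n$-cycle (the boundary) together with a central vertex joined by one edge to each boundary vertex. Fibonacci numbers: $F_0=0,F_1=1$, $F_{k+1}=F_k+F_{k-1}$; Lucas numbers: $A_0=2,A_1=1$, $A_{k+1}=A_k+A_{k-1}$. For a finite connected multigraph $\Gamma$ without self-loops, with vertex set $\mathcal{V}$, sink $v_*$ and $\mathcal{V}'=\mathcal{V}\setminus\{v_*\}$: $d(v)$ is the degree of $v$ in $\Gamma$ (including edges to the sink). The Laplacian $L$ is the $\mathcal{V}\times\mathcal{V}$ matrix with $L_{vv}=d(v)$ and $L_{vw}=-\#(v,w)$ for $v\ne w$, where $\#(v,w)$ is the number of edges joining $v$ and $w$. The reduced Laplacian $L'$ is the $\mathcal{V}'\times\mathcal{V}'$ matrix obtained from $L$ by deleting the row and column of $v_*$. Inequalities between functions on $\mathcal{V}'$ are pointwise, and constants such as $1$ denote constant functions. An element $\sigma\in\mathbb{Z}^{\mathcal{V}'}$ is uniformly large if $\sigma\ge d-1$. Odometers: for $G\in\{\mathbb{Z},\mathbb{R}\}$ and $\sigma\in\mathbb{Z}^{\mathcal{V}'}$, the $G$-odometer $u_\sigma^G\in G^{\mathcal{V}'}$ is the (existing and unique) element satisfying $\sigma-L'u\le d-1$ and $u\ge 0$ which is minimal, i.e. $u_\sigma^G\le u$ for every $u\in G^{\mathcal{V}'}$ satisfying both inequalities. $\sigma$ is immutable if $u_\sigma^{\mathbb{Z}}=u_\sigma^{\mathbb{R}}$. *)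

(* Defs.v *)
From HB Require Import structures.
From mathcomp Require Import all_boot all_order all_algebra.
From mathcomp Require Import reals.
Set Implicit Arguments.
Unset Strict Implicit.
Unset Printing Implicit Defensive.
Import Order.TTheory GRing.Theory Num.Theory.
Local Open Scope ring_scope.

Record multigraph := Multigraph {
  vertex :> finType;
  nedges : vertex -> vertex -> nat;
  nedges_sym : forall v w, nedges v w = nedges w v;
  nedges_loopless : forall v, nedges v v = 0%N;
  nedges_connected : forall v w, connect (fun x y => 0 < nedges x y)%N v w }.

Section SandpileGraph.
Variables (Gamma : multigraph) (s : Gamma).

Definition degree (v : Gamma) : nat := (\sum_(w : Gamma) nedges v w)%N.

Definition laplacian (v w : Gamma) : int :=
  if v == w then (degree v)%:Z else - (nedges v w)%:Z.

Definition nonsink : finType := {v : Gamma | v != s}.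

Definition reduced_laplacian (v w : nonsink) : int := laplacian (val v) (val w).

(* G is meant to be int or a type of real numbers. *)
Definition reduced_laplacian_app (G : numDomainType) (u : {ffun nonsink -> G}) :
    {ffun nonsink -> G} :=
  [ffun v => \sum_(w : nonsink) (reduced_laplacian v w)%:~R * u w].

Definition in_laplacian_image (sigma : {ffun nonsink -> int}) : Prop :=
  exists u : {ffun nonsink -> int}, sigma = reduced_laplacian_app u.

Definition uniformly_large (sigma : {ffun nonsink -> int}) : Prop :=
  forall v : nonsink, (degree (val v))%:Z - 1 <= sigma v.

Definition stabilizing (G : numDomainType) (sigma : {ffun nonsink -> int})
    (u : {ffun nonsink -> G}) : Prop :=
  (forall v : nonsink, (sigma v)%:~R - reduced_laplacian_app u v
               <= (degree (val v))%:R - 1) /\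
  (forall v : nonsink, 0 <= u v).

Definition is_odometer (G : numDomainType) (sigma : {ffun nonsink -> int})
    (u : {ffun nonsink -> G}) : Prop :=
  stabilizing sigma u /\
  forall u' : {ffun nonsink -> G}, stabilizing sigma u' -> forall v : nonsink, u v <= u' v.

Lemma is_odometer_unique (G : numDomainType) (sigma : {ffun nonsink -> int})
    (u u' : {ffun nonsink -> G}) :
  is_odometer sigma u -> is_odometer sigma u' -> u = u'.
Proof.
move=> [su mu] [su' mu']; apply/ffunP=> v.
by apply/eqP; rewrite eq_le mu // mu'.
Qed.

Definition immutable (R : realType) (sigma : {ffun nonsink -> int}) : Prop :=
  exists (uZ : {ffun nonsink -> int}) (uR : {ffun nonsink -> R}),
    [/\ is_odometer sigma uZ, is_odometer sigma uR &
        forall v, uR v = (uZ v)%:~R].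

End SandpileGraph.

Section Wheel.
Variable n : nat.

(* None is the central vertex and Some i the boundary vertex v_i.  The two
   summands count the cycle edges {v_i, v_(i+1)} and {v_j, v_(j+1)}; at most
   one of them is nonzero when 2 < n. *)
Definition wheel_nedges (v w : option 'Z_n) : nat :=
  match v, w with
  | Some i, Some j => ((j == i + 1)%R + (i == j + 1)%R)%N
  | None, None => 0%N
  | _, _ => 1%N
  end.

Lemma wheel_nedges_sym v w : wheel_nedges v w = wheel_nedges w v.
Proof. by case: v w => [i|] [j|] //=; rewrite addnC. Qed.

Lemma wheel_nedges_loopless v : wheel_nedges v v = 0%N.
Proof.
by case: v => [i|] //=; rewrite -{1 3}[i]addr0 (inj_eq (addrI i)) eq_sym oner_eq0.
Qed.

Lemma wheel_nedges_connected v w :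
  connect (fun x y => 0 < wheel_nedges x y)%N v w.
Proof.
apply: (@connect_trans _ _ None).
  by case: v => [i|]; [apply: connect1 | apply: connect0].
by case: w => [i|]; [apply: connect1 | apply: connect0].
Qed.

(* The wheel W_(n+1), for 1 < n. *)
Definition wheel : multigraph :=
  Multigraph wheel_nedges_sym wheel_nedges_loopless wheel_nedges_connected.

Definition hub : wheel := None.

Definition rim (i : 'Z_n) : nonsink hub := exist _ (Some i : wheel) isT.

End Wheel.

Fixpoint fib (k : nat) : nat :=
  match k with
  | 0 => 0%N
  | k'.+1 => match k' with 0 => 1%N | k''.+1 => (fib k' + fib k'')%N end
  end.

Fixpoint lucas (k : nat) : nat :=
  match k with
  | 0 => 2%N
  | k'.+1 => match k' with 0 => 1%N | k''.+1 => (lucas k' + lucas k'')%N end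
  end.

Definition even_wheel_sum (n : nat) (sigma : {ffun nonsink (hub n) -> int})
    (i : 'Z_n) : int :=
  (lucas n)%:Z * sigma (rim (i + (n./2)%:R)) + (lucas 0)%:Z * sigma (rim i)
  + \sum_(1 <= m < n./2)
      (lucas (2 * m)%N)%:Z * (sigma (rim (i + m%:R)) + sigma (rim (i - m%:R))).

Definition odd_wheel_sum (n : nat) (sigma : {ffun nonsink (hub n) -> int})
    (i : 'Z_n) : int :=
  (fib n)%:Z * sigma (rim (i + (n.+1)./2%:R))
  + \sum_(1 <= m < (n.-1)./2.+1)
      (fib (2 * m).-1)%N%:Z *
      (sigma (rim (i + m%:R)) + sigma (rim (i + 1 - m%:R))).

Definition wheel_congruence (n : nat) (sigma : {ffun nonsink (hub n) -> int})
    (i : 'Z_n) : Prop :=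
  if odd n then (odd_wheel_sum sigma i = 0 %[mod (lucas n)%:Z])%Z
  else (even_wheel_sum sigma i = 0 %[mod (5 * fib n)%N%:Z])%Z.

(* Main.v *)
Require Import Defs.
From HB Require Import structures.
From mathcomp Require Import all_boot all_order all_algebra.
From mathcomp Require Import reals.
From mathcomp Require Import zify ring lra.
Set Implicit Arguments.
Unset Strict Implicit.
Unset Printing Implicit Defensive.
Import Order.TTheory GRing.Theory Num.Theory.
Local Open Scope ring_scope.

(** Every rim vertex of the wheel has degree 3, so the reduced Laplacian is the
circulant operator [(L f)_i = 3 f_i - f_(i+1) - f_(i-1)] on functions on [Z/n].
The solutions of [g (m+1) + g (m-1) = 3 g m] are the combinations of
[phi ^ (2m)] and [phi ^ (-2m)], where [phi] is the golden ratio.  The Green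
function of [L] on the cycle has to be invariant under [m <-> n - m], so it is
a multiple of [phi ^ k + phi ^ (-k)] with [k = n - 2m].  This is the Lucas
number [A_|k|] for even [k], and the square root of 5 times the Fibonacci number
[F_|k|] for odd [k].  Hence take [g m = A_|n - 2m|] if [n] is even and
[g m = F_|n - 2m|] if [n] is odd; then [L g] is [5 F_n], respectively [A_n],
times the delta function at 0 ([green_laplacian]).

Write [N] for this factor and [G] for the correlation with [g].  Then
[G L = L G = N] over any commutative ring.  Over the integers this says that
[sigma = L f] forces [G sigma = N f], and that if [N] divides [G sigma] then
[L (G sigma / N) = sigma].  Hence [sigma] is in the image if and only if [N]
divides all values of [G sigma] ([in_image_green]).  These values are the sums
in the congruences, up to the translation of the index by half a turn that moves
the largest coefficient of [g] to the vertex opposite to [i]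
([wheel_congruence_green]).

For a uniformly large [sigma] the odometer over the reals is the solution of
[L u = sigma - 2], which topples [sigma] to exactly [d - 1 = 2] everywhere: by
the minimum principle for [L] this solution is nonnegative and lies below every
other stabilizing function ([is_odometer_solution]).  So [sigma] is immutable if
and only if the real solution is integral, that is, if and only if [sigma - 2]
is in the image of the integers.  As [L 2 = 2], this means that [sigma] is. *)

(** * Fibonacci and Lucas identities *)

Lemma fibSS k : fib k.+2 = (fib k.+1 + fib k)%N. Proof. by []. Qed.
Lemma lucasSS k : lucas k.+2 = (lucas k.+1 + lucas k)%N. Proof. by []. Qed.

Lemma lucas_fib k : lucas k.+1 = (fib k + fib k.+2)%N.
Proof.
elim/ltn_ind: k => -[|[|k]] // IHk.
rewrite lucasSS !IHk // !fibSS; lia.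
Qed.

Lemma lucas_jump k : (5 * fib k.+2 + 2 * lucas k = 3 * lucas k.+2)%N.
Proof.
case: k => [|k] //.
rewrite (lucas_fib k.+2) (lucas_fib k) !fibSS; lia.
Qed.

Lemma fib_jump k : (lucas k.+2 + 2 * fib k = 3 * fib k.+2)%N.
Proof. rewrite (lucas_fib k.+1) !fibSS; lia. Qed.

(** The numbers [seed n k] with [k = |n - 2m|] are the values of the Green
function of the cycle, so [k] is meant to have the parity of [n]. *)
Definition seed (n k : nat) : nat := if odd n then fib k else lucas k.

(** The factor by which the Laplacian of the Green function differs from the
delta function. *)
Definition modulus (n : nat) : nat := if odd n then lucas n else (5 * fib n)%N.

(** On indices of a fixed parity, Fibonacci and Lucas numbers both satisfy
[x_(k+2) + x_(k-2) = 3 x_k].  The parity hypothesis is what makes this survive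
the absolute value at [k = 0], where the Lucas case reads [3 + 3 = 3 * 2], and
at [k = 1], where the Fibonacci case reads [2 + 1 = 3 * 1]. *)
Lemma seed_rec n (k : int) : odd (absz k) = odd n ->
  (seed n (absz (k + 2)%R) + seed n (absz (k - 2)%R) = 3 * seed n (absz k))%N.
Proof.
rewrite /seed => kn.
(* Both sides are invariant under the reflection of k. *)
wlog k0 : k kn / 0 <= k => [hw|].
  have [/hw -> //|/ltW k0] := leP 0 k.
  rewrite -(abszN k) -hw ?abszN ?oppr_ge0 // addnC.
  by congr ((if _ then fib _ else lucas _) + (if _ then fib _ else lucas _))%N; lia.
case: k k0 kn => // -[|[|k]] _ kn.
- by rewrite -kn.
- by rewrite -kn.
have -> : absz (k.+2%:Z + 2)%R = k.+4 by lia.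
have -> : absz (k.+2%:Z - 2)%R = k by lia.
have -> : absz (k.+2) = k.+2 by lia.
case: ifP => _; rewrite ?(fibSS k.+2) ?(fibSS k.+1) ?(fibSS k)
  ?(lucasSS k.+2) ?(lucasSS k.+1) ?(lucasSS k); lia.
Qed.

(** The recurrence fails at the kink [m = 0] of the Green function, where both
neighbours have the value [seed n (n - 2)]; the modulus is the defect. *)
Lemma modulus_seed n : (1 < n)%N ->
  (modulus n + 2 * seed n (n - 2) = 3 * seed n n)%N.
Proof.
case: n => [|[|n]] // _; rewrite subSS subSS subn0 /modulus /seed.
by case: ifP => _; [exact: fib_jump|exact: lucas_jump].
Qed.

Lemma modulus_gt0 n : (1 < n)%N -> (0 < modulus n)%N.
Proof.
have fib_gt0 k : (0 < fib k.+1)%N.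
  by elim: k => // k IHk; rewrite fibSS; lia.
case: n => [|[|n]] // _; rewrite /modulus.
case: ifP => _; have := fib_gt0 n.+1; last by lia.
by have := lucas_fib n.+1; have := fib_gt0 n.+2; lia.
Qed.

(** * The Green function of the cycle *)

Section CyclicLaplacian.
Variable n : nat.
Hypothesis n_ge3 : (3 <= n)%N.

Definition cyclic_laplacian (K : comNzRingType) (f : 'Z_n -> K) (i : 'Z_n) : K :=
  3 * f i - f (i + 1) - f (i - 1).

Definition green (j : 'Z_n) : nat := seed n (absz (n%:Z - (2 * j)%N%:Z)%R).

Definition green_conv (K : comNzRingType) (f : 'Z_n -> K) (i : 'Z_n) : K :=
  \sum_j (green j)%:R * f (i + j).

Lemma val_natZ m : (m%:R : 'Z_n) = (m %% n)%N :> nat.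
Proof. by rewrite val_Zp_nat //; lia. Qed.

Lemma Zn_lt (j : 'Z_n) : (j < n)%N.
Proof. by rewrite -[X in (_ < X)%N](@Zp_cast n) //; lia. Qed.

Lemma natZ_n : (n%:R : 'Z_n) = 0.
Proof. by apply: val_inj; rewrite [LHS]val_natZ modnn. Qed.

(** The bound [m <= n] includes [n]: the formula takes the same value at both
ends, which is why the recurrence also holds across the seam at [n - 1]. *)
Lemma green_nat m : (m <= n)%N -> green m%:R = seed n (absz (n%:Z - (2 * m)%N%:Z)%R).
Proof.
rewrite /green val_natZ leq_eqVlt => /orP[/eqP->|/modn_small->//].
by rewrite modnn; congr (seed _ _); lia.
Qed.

Lemma green_laplacian (K : comNzRingType) (j : 'Z_n) :
  cyclic_laplacian (fun k => (green k)%:R : K) j = (modulus n)%:R *+ (j == 0).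
Proof.
rewrite /cyclic_laplacian.
(* A natural-number form of the claim, with the subtractions moved across. *)
suff H : (green (j + 1)%R + green (j - 1)%R + modulus n * (j == 0)%R = 3 * green j)%N.
  rewrite -natrM -H !natrD natrM mulr_natr.
  set a := _%:R; set b := _%:R; set c := _ *+ _; ring.
rewrite -[j](natr_Zp j); move: (Zn_lt j); move: (nat_of_ord j) => m.
have -> : (m%:R == 0 :> 'Z_n) = (m %% n == 0)%N.
  by rewrite -(inj_eq val_inj) [X in X == _]val_natZ.
case: m => [|m] mn.
  rewrite mod0n eqxx muln1.
  have -> : (0%:R - 1 : 'Z_n) = (n.-1)%:R.
    by apply/eqP; rewrite subr_eq natr1 prednK ?natZ_n //; lia.
  rewrite [_ + 1 in LHS]natr1 !green_nat; [|lia..].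
  have -> : (absz (n%:Z - (2 * 1)%N%:Z)%R) = (n - 2)%N by lia.
  have -> : (absz (n%:Z - (2 * n.-1)%N%:Z)%R) = (n - 2)%N by lia.
  have -> : (absz (n%:Z - (2 * 0)%N%:Z)%R) = n by lia.
  have := @modulus_seed n; lia.
have -> : m.+1%:R - 1 = m%:R :> 'Z_n by rewrite -natr1 addrK.
rewrite (modn_small mn) muln0 addn0 natr1 !green_nat; [|lia..].
rewrite -seed_rec; last lia.
by rewrite addnC; congr (seed _ _ + seed _ _)%N; lia.
Qed.

(** Summation by parts: the Laplacian is symmetric, so it can be moved from [f]
to the Green function. *)
Lemma green_conv_laplacian (K : comNzRingType) (f : 'Z_n -> K) i :
  green_conv (cyclic_laplacian f) i = (modulus n)%:R * f i.
Proof.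
transitivity (\sum_j cyclic_laplacian (fun k => (green k)%:R : K) j * f (i + j)).
  rewrite /green_conv /cyclic_laplacian.
  under eq_bigr do rewrite 2!mulrBr.
  under [RHS]eq_bigr do rewrite 2!mulrBl.
  rewrite !sumrB -!addrA; congr (_ + _).
    by apply: eq_bigr => j _; ring.
  rewrite addrC; congr (- _ - _).
  - rewrite (reindex_inj (addIr 1)) /=; apply: eq_bigr => j _.
    by rewrite addrA addrK.
  - rewrite (reindex_inj (addIr (-1))) /=; apply: eq_bigr => j _.
    by rewrite -addrA addrNK.
under eq_bigr do rewrite green_laplacian.
rewrite (bigD1 0) //= big1 ?addr0 => [|j /negbTE->]; last by rewrite mul0r.
by rewrite mulr1n.
Qed.

(** The two operators commute because each is a combination of translations. *)
Lemma laplacian_green_conv (K : comNzRingType) (f : 'Z_n -> K) i :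
  cyclic_laplacian (green_conv f) i = (modulus n)%:R * f i.
Proof.
rewrite -green_conv_laplacian /green_conv /cyclic_laplacian.
rewrite mulr_sumr -!sumrB; apply: eq_bigr => j _.
by rewrite (addrAC i 1) (addrAC i (-1)); ring.
Qed.

(** At a point [m] where [f] is minimal, [3 f_m >= f_(m+1) + f_(m-1) >= 2 f_m]. *)
Lemma minimum_principle (K : realDomainType) (f : 'Z_n -> K) :
  (forall i, 0 <= cyclic_laplacian f i) -> forall i, 0 <= f i.
Proof.
move=> Lf i.
have [m _ fm] := @Order.TotalTheory.arg_minP _ _ _ (i : 'Z_n) predT f isT.
apply: le_trans (fm i isT).
have := Lf m; have := fm (m + 1) isT; have := fm (m - 1) isT.
rewrite /cyclic_laplacian; lra.
Qed.
End CyclicLaplacian.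

(** * The reduced Laplacian of the wheel *)

Section WheelLaplacian.
Variable n : nat.
Hypothesis n_ge3 : (3 <= n)%N.

Lemma rim_onto (v : nonsink (hub n)) : exists i, v = rim i.
Proof. by case: v => -[i|] // p; exists i; apply: val_inj. Qed.

Lemma rim_bij : bijective (@rim n).
Proof.
apply: (@Bijective _ _ _ (fun v => odflt 0 (val v : option 'Z_n))) => //.
by move=> v; have [i ->] := rim_onto v.
Qed.

Lemma degree_rim i : degree (val (@rim n i)) = 3%N.
Proof.
rewrite /degree (bigD1 (hub n)) //=.
rewrite (reindex_omap (Some : 'Z_n -> wheel n) id) /=; last by case.
under eq_bigl do rewrite eqxx.
rewrite big_split /=.
have sum1 (k : 'Z_n) : (\sum_j (j == k) = 1)%N.
  by rewrite (bigD1 k) //= eqxx big1 // => j /negbTE->.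
rewrite sum1; congr (1 + (1 + _))%N; rewrite -[RHS](sum1 (i - 1)).
by apply: eq_bigr => j _; rewrite -subr_eq eq_sym.
Qed.

Lemma reduced_laplacian_rim i j : reduced_laplacian (@rim n i) (rim j) =
  3 * (j == i)%:Z - (j == i + 1)%:Z - (j == i - 1)%:Z.
Proof.
rewrite /reduced_laplacian /laplacian degree_rim /=.
have -> : (Some i == Some j :> wheel n) = (j == i).
  by rewrite eq_sym; apply: (inj_eq (@Some_inj _)).
have succ_neq : (i == i + 1) = false.
  by rewrite -{1}[i]addr0 (inj_eq (addrI i)) eq_sym oner_eq0.
have [->|_] := eqVneq j i; first by rewrite [i == i - 1]eq_sym subr_eq succ_neq.
rewrite [j == i - 1]eq_sym subr_eq.
by rewrite PoszD opprD mulr0 add0r.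
Qed.

Lemma reduced_laplacian_app_rim (G : numDomainType)
    (u : {ffun nonsink (hub n) -> G}) i :
  reduced_laplacian_app u (rim i) = cyclic_laplacian (fun k => u (rim k)) i.
Proof.
rewrite ffunE (reindex (@rim n)) /=; last exact: onW_bij rim_bij.
under eq_bigr do rewrite reduced_laplacian_rim 2!intrB 2!mulrBl intrM -mulrA.
rewrite !sumrB /cyclic_laplacian -mulr_sumr.
have sum_delta (k : 'Z_n) : \sum_j (j == k)%:Z%:~R * u (rim j) = u (rim k).
  rewrite (bigD1 k) //= eqxx mul1r big1 ?addr0 // => j /negbTE->.
  by rewrite mul0r.
by rewrite !sum_delta.
Qed.

Lemma in_image_rim (sigma : {ffun nonsink (hub n) -> int}) :
  in_laplacian_image sigma <->
  exists f : 'Z_n -> int, forall i, sigma (rim i) = cyclic_laplacian f i.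
Proof.
split=> [[u ->]|[f sigmaE]].
  by exists (fun i => u (rim i)) => i; rewrite reduced_laplacian_app_rim.
have [rimV rimK _] := rim_bij; exists [ffun v => f (rimV v)].
apply/ffunP => v; have [i ->] := rim_onto v.
rewrite reduced_laplacian_app_rim sigmaE /cyclic_laplacian.
by rewrite !ffunE !rimK.
Qed.

Lemma in_image_green (sigma : {ffun nonsink (hub n) -> int}) :
  in_laplacian_image sigma <->
  forall i, ((modulus n)%:Z %| green_conv (fun j => sigma (rim j)) i)%Z.
Proof.
have N_neq0 : (modulus n)%:Z != 0 by have := @modulus_gt0 n; lia.
rewrite in_image_rim; split=> [[f sigmaE] i|dvdN].
  apply/dvdzP; exists (f i); rewrite mulrC -[(modulus n)%:Z]natz -green_conv_laplacian //.
  by apply: eq_bigr => j _; rewrite sigmaE.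
set g := green_conv _ in dvdN *.
exists (fun i => g i %/ (modulus n)%:Z)%Z => i; apply: (mulfI N_neq0).
rewrite -{1}natz -(laplacian_green_conv n_ge3 (fun j => sigma (rim j))) -/g.
rewrite /cyclic_laplacian 2!mulrBr mulrCA.
by rewrite ![(modulus n)%:Z * _]mulrC !divzK.
Qed.

(** * The congruences as values of the Green correlation *)

Lemma green_conv_nat (K : comNzRingType) (f : 'Z_n -> K) i :
  green_conv f i =
  \sum_(0 <= m < n) (seed n (absz (n%:Z - (2 * m)%N%:Z)%R))%:R * f (i + m%:R).
Proof.
rewrite /green_conv /green.
case: n n_ge3 f i => [|[|[|p]]] // _ f i.
by rewrite big_mkord; apply: eq_bigr => j _; rewrite natr_Zp.
Qed.

(** The correlation at [i + c], where [c] is [n / 2] rounded up, has the weight of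
index [|n - 2m|] at the vertex [i + c + m].  The terms with [m >= c] run forwards
from [i] (from [i + 1] for odd [n]) with growing index, and those with [m < c],
taken in the reverse order, run backwards from [i - 1] (from [i] for odd [n]),
again with growing index.  Terms of equal index pair up.  The last backward term,
of index [n] at the opposite vertex, stays alone, and so does the first forward
term, of index 0, for even [n]. *)
Lemma wheel_congruence_green (sigma : {ffun nonsink (hub n) -> int}) i :
  wheel_congruence sigma i <->
  ((modulus n)%:Z %| green_conv (fun j => sigma (rim j)) (i + (n.+1)./2%:R))%Z.
Proof.
pose s j := sigma (rim j).
set c := (n.+1)./2; rewrite green_conv_nat (@big_cat_nat _ _ _ c) //=; last lia.
have n_half := odd_double_half n.
have upper : \sum_(c <= m < n) (seed n (absz (n%:Z - (2 * m)%N%:Z)%R))%:R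
      * s (i + c%:R + m%:R)
    = \sum_(0 <= k < n./2) (seed n (2 * k + odd n)%N)%:R
      * s (i + (odd n)%:R + k%:R).
  rewrite -{1}[c]add0n big_addn.
  have -> : (n - c = n./2)%N by lia.
  apply: eq_big_nat => k kn; congr (_%:R * s _).
    by congr seed; lia.
  rewrite -!addrA -!natrD; congr (i + _).
  have -> : (c + (k + c) = n + (odd n + k))%N by lia.
  by rewrite natrD natZ_n // add0r.
(* Twice the half turn is the identity, or one step if n is odd. *)
have cc : c%:R + c%:R = (odd n)%:R :> 'Z_n.
  have eq_cc : (c + c = n + odd n)%N by lia.
  by rewrite -natrD eq_cc natrD natZ_n // add0r.
have lower : \sum_(0 <= m < c) (seed n (absz (n%:Z - (2 * m)%N%:Z)%R))%:R
      * s (i + c%:R + m%:R)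
    = \sum_(0 <= k < c) (seed n (2 * k.+1 - odd n)%N)%:R
      * s (i + (odd n)%:R - k.+1%:R).
  rewrite big_nat_rev /=.
  apply: eq_big_nat => k kn; congr (_%:R * s _).
    by congr seed; lia.
  rewrite add0n natrB; last lia.
  by rewrite addrA -(addrA i) cc.
rewrite lower upper /wheel_congruence /modulus /seed.
have mod_dvd (a d : int) : (a = 0 %[mod d])%Z <-> (d %| a)%Z.
  by rewrite -[a in X in _ <-> X]subr0 -eqz_mod_dvd; split=> /eqP.
have half_shift : s (i + (odd n)%:R - c%:R) = s (i + c%:R).
  by rewrite -cc addrA addrK.
case: (boolP (odd n)) cc n_half half_shift => n_odd cc n_half half_shift.
  have cE : c = n./2.+1 by rewrite /c; lia.
  rewrite mod_dvd cE big_nat_recr //= -cE half_shift.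
  have -> : (2 * c - true = n)%N by lia.
  suff -> : odd_wheel_sum sigma i =
     \sum_(0 <= k < n./2) (fib (2 * k.+1 - true))%:R * s (i + true%:R - k.+1%:R)
     + (fib n)%:R * s (i + c%:R)
     + \sum_(0 <= k < n./2) (fib (2 * k + true))%:R * s (i + true%:R + k%:R) by [].
  rewrite addrAC -big_split /= addrC /odd_wheel_sum natz; congr (_ + _).
  have -> : (n.-1)./2 = n./2 by lia.
  rewrite big_add1 /=; apply: eq_big_nat => k _.
  have -> : (2 * k.+1 - true = (2 * k.+1).-1)%N by lia.
  have -> : (2 * k + true = (2 * k.+1).-1)%N by lia.
  by rewrite natz -mulrDr [X in _ = _ * X]addrC -[i + _ + k%:R]addrA -natrD.
have [p pE] : exists p, n./2 = p.+1 by exists (n./2.-1); lia.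
have cE : c = p.+1 by rewrite /c; lia.
rewrite mod_dvd cE pE big_nat_recr // big_nat_recl // -cE half_shift.
have -> : (2 * c - false = n)%N by lia.
suff -> : even_wheel_sum sigma i =
   \sum_(0 <= k < p) (lucas (2 * k.+1 - false))%:R * s (i + false%:R - k.+1%:R)
   + (lucas n)%:R * s (i + c%:R)
   + ((lucas (2 * 0 + false))%:R * s (i + false%:R + 0%:R)
   + \sum_(0 <= k < p) (lucas (2 * k.+1 + false))%:R
       * s (i + false%:R + k.+1%:R)) by [].
set S1 := \sum_(0 <= k < p) _; set S2 := \sum_(0 <= k < p) _.
have -> : S1 + (lucas n)%:R * s (i + c%:R)
    + ((lucas (2 * 0 + false))%:R * s (i + false%:R + 0%:R) + S2)
    = (lucas n)%:R * s (i + c%:R) + (lucas 0)%:R * s i + (S2 + S1).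
  by rewrite !addr0; ring.
rewrite /even_wheel_sum pE cE !natz big_add1 -big_split; congr (_ + _).
apply: eq_big_nat => k _; by rewrite -[RHS]/(_ + _) !addr0 subn0 addn0 natz -mulrDr.
Qed.
End WheelLaplacian.

(** * Odometers of uniformly large configurations *)

Section Odometers.
Variable n : nat.
Hypothesis n_ge3 : (3 <= n)%N.
Variable sigma : {ffun nonsink (hub n) -> int}.
Hypothesis sigma_large : uniformly_large sigma.

(** Both nonnegativity and minimality are instances of the minimum principle:
[L u = sigma - 2] is nonnegative because [sigma] is uniformly large, and
[L (u' - u)] is nonnegative because [u'] is stabilizing.  The ordered ring [K]
is arbitrary so that integral and real odometers are treated together. *)
Lemma is_odometer_solution (K : realDomainType) (u : {ffun nonsink (hub n) -> K}) :
  (forall i, reduced_laplacian_app u (rim i) = (sigma (rim i))%:~R - 2) ->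
  is_odometer sigma u.
Proof.
move=> uE; split=> [|u' [u'_stab _]].
  split=> v; have [i ->] := rim_onto v.
    by rewrite uE degree_rim // subKr; lra.
  apply: (@minimum_principle n K (fun j => u (rim j))) => j.
  rewrite -reduced_laplacian_app_rim // uE subr_ge0.
  have := sigma_large (rim j); rewrite degree_rim //.
  by rewrite -(ler_int K) => /le_trans; apply.
move=> v; have [i ->] := rim_onto v; rewrite -subr_ge0.
apply: (@minimum_principle n K (fun j => u' (rim j) - u (rim j))) => j.
have -> : cyclic_laplacian (fun j => u' (rim j) - u (rim j)) j =
    reduced_laplacian_app u' (rim j) - reduced_laplacian_app u (rim j).
  by rewrite !reduced_laplacian_app_rim // /cyclic_laplacian; ring.
by have := u'_stab (rim j); rewrite uE degree_rim //; lra.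
Qed.

Lemma solution_exists (K : numFieldType) : exists u : {ffun nonsink (hub n) -> K},
  forall i, reduced_laplacian_app u (rim i) = (sigma (rim i))%:~R - 2.
Proof.
have [rimV rimK _] := rim_bij n; pose f i : K := (sigma (rim i))%:~R - 2.
have N_neq0 : (modulus n)%:R != 0 :> K.
  by rewrite pnatr_eq0 -lt0n modulus_gt0 // ltnW.
exists [ffun v => (modulus n)%:R^-1 * green_conv f (rimV v)] => i.
rewrite reduced_laplacian_app_rim // -[RHS](mulKf N_neq0).
rewrite -[X in _ * X](laplacian_green_conv n_ge3 f).
by rewrite /cyclic_laplacian !ffunE !rimK; ring.
Qed.

Lemma immutable_iff_image (R : realType) :
  immutable R sigma <-> in_laplacian_image sigma.
Proof.
rewrite in_image_rim //; split=> [[uZ [uR [_ odoR uRE]]]|[f sigmaE]].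
  have [u uE] := solution_exists R.
  have uR_u := is_odometer_unique odoR (is_odometer_solution uE).
  (* The shift by 2 accounts for d - 1, as constants are fixed by L. *)
  exists (fun i => uZ (rim i) + 2) => i; apply: (@intr_inj R).
  rewrite -[LHS](subrK 2) -uE -uR_u reduced_laplacian_app_rim // /cyclic_laplacian !uRE.
  by rewrite !(intrB, intrM, intrD, mulr1z); ring.
have [rimV rimK _] := rim_bij n.
exists [ffun v => f (rimV v) - 2], [ffun v => (f (rimV v) - 2)%:~R].
split=> [||v]; last by rewrite !ffunE.
  apply: is_odometer_solution => i; rewrite reduced_laplacian_app_rim //.
  by rewrite sigmaE /cyclic_laplacian !ffunE !rimK intz; ring.
apply: is_odometer_solution => i; rewrite reduced_laplacian_app_rim //.
rewrite sigmaE /cyclic_laplacian !ffunE !rimK !(intrB, intrM, intrD, mulr1z); ring.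
Qed.
End Odometers.

Theorem theorem5p6 (R : realType) (n : nat) (n_ge3 : (3 <= n)%N)
    (sigma : {ffun nonsink (hub n) -> int}) :
  (in_laplacian_image sigma <-> (forall i : 'Z_n, wheel_congruence sigma i)) /\
  (uniformly_large sigma ->
    (immutable R sigma <-> (forall i : 'Z_n, wheel_congruence sigma i))).
Proof.
have image_iff : in_laplacian_image sigma <->
    (forall i : 'Z_n, wheel_congruence sigma i).
  rewrite in_image_green //; split=> [dvdN i|congN i].
    by apply/wheel_congruence_green.
  rewrite -[i](subrK (n.+1)./2%:R).
  by apply/wheel_congruence_green.
split=> // sigma_large; rewrite -image_iff.
by apply: immutable_iff_image.
Qed.
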